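(* Let $X$ be a set. A relation $\vdash$ from $PX$ to $X$ is a consequence relation on $X$ if and only if $\vdash$ is a monoid on $X$ in $\mathsf{MRel}$, that is, $\vdash$ is monotone (hence a morphism from $X$ to $X$ in $\mathsf{MRel}$) and satisfies $\Delta_X\subseteq{\vdash}$ (unit) and $({\vdash}\circ{\vdash})\subseteq{\vdash}$ (multiplication).
   Context: $PX$ denotes the powerset of $X$. A consequence relation $\vdash$ on $X$ is a relation $\vdash$ from $PX$ to $X$ such that for all $A,B\subseteq X$ and $x\in X$: (1) if $x\in A$ then $A\vdash x$; (2) if $A\vdash x$ and $A\subseteq B$ then $B\vdash x$; (3) if $A\vdash y$ for all $y\in B$ and $B\vdash x$, then $A\vdash x$. For relations $r$ from $X$ to $Y$ and $s$ from $Y$ to $Z$, $s\cdot r$ is the usual relational composite: $x\,(s\cdot r)\,z$ iff there is $y\in Y$ with $x\,r\,y$ and $y\,s\,z$. Relations are ordered by inclusion. For a function $f:X\to Y$, $f^\circ$ is the relation from $Y$ to $X$ with $y\,f^\circ\,x$ iff $f(x)=y$. For a relation $r$ from $X$ to $Y$, $\hat{P}r$ is the relation from $PX$ to $PY$ with $A\,(\hat{P}r)\,B$ iff for all $y\in B$ there is $x\in A$ with $x\,r\,y$. Let $m_X:PPX\to PX$, $\mathcal{A}\mapsto\bigcup\mathcal{A}$. A relation $r$ from $PX$ to $Y$ is monotone if $A\,r\,y$ and $A\subseteq B$ imply $B\,r\,y$. $\mathsf{MRel}$ is the category whose objects are sets, whose morphisms from $X$ to $Y$ are the monotone relations from $PX$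 to $Y$, whose composition (for $r$ from $PX$ to $Y$ and $s$ from $PY$ to $Z$) is $s\circ r:=s\cdot(\hat{P}r)\cdot m_X^\circ$ (a relation from $PX$ to $Z$), and whose identity on $X$ is $\Delta_X$, given by $A\,\Delta_X\,x$ iff $x\in A$. *)

(* Defs.v *)
From mathcomp Require Import all_boot boolp classical_sets.
Set Implicit Arguments. Unset Strict Implicit. Unset Printing Implicit Defensive.
Local Open Scope classical_set_scope.

(* A relation from X to Y is a [set (X * Y)], ordered by inclusion [`<=`], and
   the powerset of X is the type [set X]. *)

Definition consequence_relation (X : Type) (r : set (set X * X)) : Prop :=
  [/\ forall (A : set X) x, A x -> r (A, x),
      forall (A B : set X) x, r (A, x) -> A `<=` B -> r (B, x)
    & forall (A B : set X) x,
        (forall y, B y -> r (A, y)) -> r (B, x) -> r (A, x)].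

Definition fun_converse (X Y : Type) (f : X -> Y) : set (Y * X) :=
  [set yx | f yx.2 = yx.1].

Definition pow_rel (X Y : Type) (r : set (X * Y)) : set (set X * set Y) :=
  [set AB | forall y, AB.2 y -> exists2 x, AB.1 x & r (x, y)].

Definition pow_mul (X : Type) (AA : set (set X)) : set X :=
  \bigcup_(A in AA) A.

Definition monotone_rel (X Y : Type) (r : set (set X * Y)) : Prop :=
  forall (A B : set X) y, r (A, y) -> A `<=` B -> r (B, y).

Definition mrel_id (X : Type) : set (set X * X) := [set Ax | Ax.1 Ax.2].
Arguments mrel_id : clear implicits.

(* The library's [s \; r] relates x to z when (x, y) is in r and (y, z) is in s. *)
Definition mrel_comp (X Y Z : Type) (s : set (set Y * Z)) (r : set (set X * Y)) :
  set (set X * Z) :=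
  ((s \; pow_rel r) \; fun_converse (@pow_mul X))%relation.

(* The hom-sets of MRel are ordered by inclusion, so the unit and the
   multiplication of a monoid are inequalities and its axioms are automatic. *)
Definition mrel_monoid (X : Type) (r : set (set X * X)) : Prop :=
  [/\ monotone_rel r, mrel_id X `<=` r & mrel_comp r r `<=` r].

(* Monotone relations, [mrel_comp] and [mrel_id] form a category. *)

Lemma mrel_id_monotone (X : Type) : monotone_rel (mrel_id X).
Proof. by move=> A B x /= Ax; apply. Qed.

Lemma mrel_compE (X Y Z : Type) (s : set (set Y * Z)) (r : set (set X * Y)) A z :
  monotone_rel r ->
  mrel_comp s r (A, z) <-> exists2 B, (forall y, B y -> r (A, y)) & s (B, z).
Proof.
move=> mr; split=> [[AA /= eqA [B /= rB sBz]]|[B rB sBz]].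
  exists B => // y /rB [A0 AA0 rA0y].
  by apply: mr rA0y _ => x A0x; rewrite -[A]eqA; exists A0.
exists [set A]; first by rewrite /fun_converse /pow_mul /= bigcup_set1.
by exists B => // y /= /rB rAy; exists A.
Qed.

Lemma mrel_comp_monotone (X Y Z : Type) (s : set (set Y * Z))
    (r : set (set X * Y)) :
  monotone_rel r -> monotone_rel (mrel_comp s r).
Proof.
move=> mr A B z /(mrel_compE _ _ _ mr) [C rC sCz] AB.
by apply/(mrel_compE _ _ _ mr); exists C => // y /rC /mr; apply.
Qed.

Lemma mrel_comp_idl (X Y : Type) (r : set (set X * Y)) :
  monotone_rel r -> mrel_comp (mrel_id Y) r = r.
Proof.
move=> mr; apply/seteqP; split=> -[A y].
  by move=> /(mrel_compE _ _ _ mr) [B rB /rB].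
by move=> rAy; apply/(mrel_compE _ _ _ mr); exists [set y] => // _ ->.
Qed.

Lemma mrel_comp_idr (X Y : Type) (r : set (set X * Y)) :
  monotone_rel r -> mrel_comp r (mrel_id X) = r.
Proof.
move=> mr; have mi := @mrel_id_monotone X.
apply/seteqP; split=> -[A y].
  by move=> /(mrel_compE _ _ _ mi) [B BA rBy]; apply: mr rBy _.
by move=> rAy; apply/(mrel_compE _ _ _ mi); exists A.
Qed.

Lemma mrel_compA (X Y Z W : Type) (t : set (set Z * W)) (s : set (set Y * Z))
    (r : set (set X * Y)) :
  monotone_rel r -> monotone_rel s ->
  mrel_comp t (mrel_comp s r) = mrel_comp (mrel_comp t s) r.
Proof.
move=> mr ms; have msr := mrel_comp_monotone (s := s) mr.
apply/seteqP; split=> -[A w].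
  move=> /(mrel_compE _ _ _ msr) [C srC tCw]; apply/(mrel_compE _ _ _ mr).
  exists [set y | r (A, y)] => //; apply/(mrel_compE _ _ _ ms); exists C => // z.
  by move=> /srC /(mrel_compE _ _ _ mr) [B rB sBz]; apply: ms sBz _.
move=> /(mrel_compE _ _ _ mr) [B rB /(mrel_compE _ _ _ ms) [C sC tCw]].
apply/(mrel_compE _ _ _ msr); exists C => // z /sC sBz.
by apply/(mrel_compE _ _ _ mr); exists B.
Qed.

(* Main.v *)
Require Import Defs.
From mathcomp Require Import all_boot boolp classical_sets.

(** Reflexivity of a consequence relation is the unit law and weakening is
    monotonicity. For the cut rule, the point is that the union in the
    composite of [MRel] collapses when [r] is monotone: a family of subsets of
    [A] jointly deriving [B] can be replaced by [A] itself ([mrel_compE]). So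
    [mrel_comp r r] holds at [(A, x)] exactly when some [B] is derivable from
    [A] and derives [x], and cut is the multiplication law with the
    existentially quantified [B] made universal. *)
Theorem proposition3 (X : Type) (r : set (set X * X)) :
  consequence_relation r <-> mrel_monoid r.
Proof.
split=> [[refl mono cut]|[mono unit mult]]; split=> //.
- by move=> [A x]; apply: refl.
- by move=> [A x] /(mrel_compE _ _ _ mono) [B rB rBx]; apply: cut rB rBx.
- by move=> A x Ax; apply: unit.
- move=> A B x rB rBx; apply: mult.
  by apply/(mrel_compE _ _ _ mono); exists B.
Qed.
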